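(* Let $\rho$ be a convex risk measure on $\mathbb L_\infty(\mathbb P)$ continuous from above, let $\gamma_A,\gamma_B>0$, $\gamma_C=\gamma_A+\gamma_B$, and let $\rho_{\gamma_A},\rho_{\gamma_B},\rho_{\gamma_C}$ be the associated $\gamma$-tolerant risk measures. Let $\mathcal V_T^A,\mathcal V_T^B$ be (nonempty) convex subsets of $\mathbb L_\infty(\mathbb P)$ such that there is a probability measure $\mathbb Q\sim\mathbb P$ with $\mathbb E_{\mathbb Q}[-\xi]\le 0$ for all $\xi\in\mathcal V_T^A\cup\mathcal V_T^B$. Let $\rho^m_{\gamma_J}=\rho_{\gamma_J}\square\nu^J$ ($J=A,B$) be the market modified risk measures, assume $\rho^m_{\gamma_A}\square\rho^m_{\gamma_B}(0)>-\infty$, let $X_T^A,X_T^B\in\mathbb L_\infty(\mathbb P)$, and consider the program $$R^m_{AB}(X_T^A+X_T^B)=\inf_{F\in\mathbb L_\infty(\mathbb P)}\big\{\rho^m_{\gamma_A}(X_T^A-F)+\rho^m_{\gamma_B}(X_T^B+F)\big\}.\qquad( * )$$ (a) If $\mathcal V_T^A=\mathcal V_T^B=\mathcal V_T$ is a (convex) cone, then an optimal solution of $( * )$ is $$F^*=\frac{\gamma_B}{\gamma_A+\gamma_B}X_T^A-\frac{\gamma_A}{\gamma_A+\gamma_B}X_T^B .$$ (b) In general, let $\mathcal V_T^{(A+B)}=\{\xi^A+\xi^B:\ \xi^A\in\mathcal V_T^A,\ \xi^B\in\mathcal V_T^B\}$ and suppose that $\xi^*=\eta_A^*+\eta_B^*$,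 with $\eta_A^*\in\mathcal V_T^A$, $\eta_B^*\in\mathcal V_T^B$, is an optimal solution of $\inf_{\xi\in\mathcal V_T^{(A+B)}}\rho_{\gamma_C}(X_T^A+X_T^B-\xi)$. Then $$F^*=\frac{\gamma_B}{\gamma_A+\gamma_B}X_T^A-\frac{\gamma_A}{\gamma_A+\gamma_B}X_T^B-\frac{\gamma_B}{\gamma_A+\gamma_B}\eta_A^*+\frac{\gamma_A}{\gamma_A+\gamma_B}\eta_B^*$$ is an optimal solution of $( * )$. Moreover: (i) $\eta_B^*$ is an optimal hedge of $X_T^B+F^*$ for agent $B$: $$\frac1{\gamma_B}\rho_{\gamma_B}(X_T^B+F^*-\eta_B^* )=\frac1{\gamma_B}\inf_{\xi_B\in\mathcal V_T^B}\rho_{\gamma_B}(X_T^B+F^*-\xi_B)=\frac1{\gamma_C}\rho_{\gamma_C}(X_T^A+X_T^B-\xi^* ).$$ (ii) $\eta_A^*$ is an optimal hedge of $X_T^A-F^*$ for agent $A$: $$\frac1{\gamma_A}\rho_{\gamma_A}\big(X_T^A-(F^*+\eta_A^* )\big)=\frac1{\gamma_A}\inf_{\xi_A\in\mathcal V_T^A}\rho_{\gamma_A}\big(X_T^A-(F^*+\xi_A)\big)=\frac1{\gamma_C}\rho_{\gamma_C}(X_T^A+X_T^B-\xi^* ).$$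
   Context: $(\Omega,\mathcal F,\mathbb P)$ is a probability space. A convex risk measure on $\mathbb L_\infty(\mathbb P)$ is a map $\rho:\mathbb L_\infty(\mathbb P)\to\mathbb R$ that is convex, decreasing ($\Phi\le\Psi$ a.s. $\Rightarrow\rho(\Phi)\ge\rho(\Psi)$) and translation invariant ($\rho(\Phi+m)=\rho(\Phi)-m$, $m\in\mathbb R$). It is continuous from above if $\Psi_n\searrow\Psi$ a.s. implies $\rho(\Psi_n)\nearrow\rho(\Psi)$. For $\gamma>0$, $\rho_\gamma(\Psi)=\gamma\rho(\Psi/\gamma)$. The inf-convolution is $(\phi\square\psi)(X)=\inf_{H\in\mathbb L_\infty(\mathbb P)}\{\phi(X-H)+\psi(H)\}$. The risk measure generated by $\mathcal V_T^J$ is $\nu^J(\Psi)=\inf\{m\in\mathbb R:\ \exists\,\xi\in\mathcal V_T^J,\ m+\Psi\ge\xi\ \text{a.s.}\}$; one has $\rho_{\gamma_J}\square\nu^J(\Psi)=\inf_{\xi\in\mathcal V_T^J}\rho_{\gamma_J}(\Psi-\xi)$. *)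

(* Defs.v *)
From mathcomp Require Export all_boot all_order all_algebra.
From mathcomp Require Export all_classical all_reals all_analysis.
From mathcomp Require Import ess_sup_inf.

Set Implicit Arguments.
Unset Strict Implicit.
Unset Printing Implicit Defensive.

Export Order.TTheory GRing.Theory Num.Theory.
Export numFieldNormedType.Exports.

Local Open Scope classical_set_scope.
Local Open Scope ring_scope.

(** [Linfty P] is the library's module of essentially bounded measurable
    functions, not its quotient by P-a.s. equality (for which the library has no
    vector space structure). Order and convergence below are P-almost sure, so
    any risk measure on it is constant on a.s.-classes. *)
Notation Linfty P := (LfunType P (leey 1%E)).

Section Linfty.
Context (d : measure_display) (T : measurableType d) (R : realType).
Variable P : probability T R.
Local Notation L := (Linfty P).

Lemma cst_in_Linfty (m : R) : cst m \in Lfun P +oo%E.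
Proof.
apply/andP; split; first by rewrite inE/=; exact: measurable_cst.
rewrite inE/= /finite_norm unlock/= probability_setT lte01.
have -> : abse \o (EFin \o cst m) = cst `|m|%:E :> (T -> \bar R) by [].
have P0 : (0 < P [set: T])%E by rewrite probability_setT lte01.
by rewrite ess_sup_cst// ltry.
Qed.

Definition Lcst (m : R) : L := Lfun_Sub (leey 1%E) (cst_in_Linfty m).

Definition ae_le (X Y : L) : Prop := {ae P, forall w, X w <= Y w}.

Record convex_risk_measure (rho : L -> R) : Prop := ConvexRiskMeasure {
  crm_convex : convex_function [set: convex_lmodType L] rho;
  crm_decreasing : forall X Y : L, ae_le X Y -> rho Y <= rho X;
  crm_translation : forall (X : L) (m : R), rho (X + Lcst m) = rho X - m
}.

Definition continuous_from_above (rho : L -> R) : Prop :=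
  forall (Y_ : nat -> L) (Y : L),
    (forall n, ae_le (Y_ n.+1) (Y_ n)) ->
    {ae P, forall w, Y_ n w @[n --> \oo] --> Y w} ->
    nondecreasing_seq (fun n => rho (Y_ n)) /\
    rho (Y_ n) @[n --> \oo] --> rho Y.

Definition tolerant (gamma : R) (rho : L -> R) (X : L) : R :=
  gamma * rho (gamma^-1 *: X).

(** Infima are taken in the extended reals, with no finiteness presupposed. *)
Definition inf_convolution (phi psi : L -> \bar R) (X : L) : \bar R :=
  ereal_inf [set (phi (X - H)%R + psi H)%E | H in [set: L]].

Definition generated_risk (V : set L) (X : L) : \bar R :=
  ereal_inf [set m%:E | m in
    [set m : R | exists2 xi : L, V xi & ae_le xi (Lcst m + X)]].

Definition market_modified (rho : L -> R) (V : set L) : L -> \bar R :=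
  inf_convolution (fun X => (rho X)%:E) (generated_risk V).

(** Only positive scalars are required to preserve a cone, so a cone need not
    contain the origin. *)
Definition cone (V : set L) : Prop :=
  forall (c : R) (xi : L), 0 < c -> V xi -> V (c *: xi).

Definition equivalent_probability (Q : probability T R) : Prop :=
  Q `<< P /\ P `<< Q.

Definition is_minimizer (D : set L) (f : L -> \bar R) (x : L) : Prop :=
  D x /\ f x = ereal_inf (f @` D).

Definition transfer_objective (phiA phiB : L -> \bar R) (XA XB F : L) : \bar R :=
  (phiA (XA - F)%R + phiB (XB + F)%R)%E.

End Linfty.

(* Main.v *)
(** Convexity of rho gives rho_C(Y + Z) <= rho_A(Y) + rho_B(Z), with equality
    when Y and Z are the shares gammaA / gammaC and gammaB / gammaC of their
    sum. Since [market_modified] is an infimum over hedges xi in V_J, every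
    transfer F costs at least the infimum of rho_C(XA + XB - xiA - xiB); the
    proposed F leaves both agents, once hedged, with proportional shares of the
    same total position, so that this bound is attained. In the cone case the
    hedges can themselves be taken to be proportional shares of one xi. *)
Require Import Defs.
From mathcomp Require Import ring lra.

Set Implicit Arguments.
Unset Strict Implicit.
Unset Printing Implicit Defensive.

Local Open Scope classical_set_scope.
Local Open Scope ring_scope.

(** Finite elements can be moved across the inequality, so one infimum is taken at a time, first
    over [A] with [b] fixed, then over [B]. *)
Lemma lee_ereal_inf_add (R : realType) (A B : set \bar R) (c : \bar R) :
  A !=set0 -> B !=set0 -> A `<=` range EFin -> B `<=` range EFin ->
  (forall a b, A a -> B b -> (c <= a + b)%E) ->
  (c <= ereal_inf A + ereal_inf B)%E.
Proof.
move=> [a0 Aa0] [b0 Bb0] Afin Bfin cAB.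
have cA b : B b -> (c - b <= ereal_inf A)%E.
  move=> Bb; apply: le_ereal_inf_tmp => a Aa; have [r _ br] := Bfin b Bb.
  by rewrite -br leeBlDr// br; exact: cAB.
have cAb b : B b -> (c <= ereal_inf A + b)%E.
  by move=> Bb; have [r _ br] := Bfin b Bb; rewrite -br -leeBlDr// br; exact: cA.
(* A finite element of [A] excludes [+oo] as its infimum. If the infimum is [-oo], the bound at [b0]
   already forces [c] to be [-oo]. *)
have [r _ ra0] := Afin a0 Aa0.
have : (ereal_inf A <= r%:E)%E by rewrite ra0; exact: ereal_inf_lbound.
case EA : (ereal_inf A) cAb => [s| |] cAb // _; last first.
  by have := cAb b0 Bb0; rewrite !addNye.
rewrite addeC -leeBlDr//; apply: le_ereal_inf_tmp => b Bb.
by rewrite leeBlDr// addeC; exact: cAb.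
Qed.

Section risk_sharing.
Context (d : measure_display) (T : measurableType d) (R : realType).
Variable P : probability T R.
Local Notation L := (Linfty P).

Lemma Linfty_addE (X Y : L) (w : T) : (X + Y) w = X w + Y w.
Proof. by []. Qed.

Lemma Linfty_oppE (X : L) (w : T) : (- X) w = - X w.
Proof. by []. Qed.

Lemma Linfty_scaleE (a : R) (X : L) (w : T) : (a *: X) w = a * X w.
Proof. by []. Qed.

Definition LinftyE := (Linfty_addE, Linfty_oppE, Linfty_scaleE).

(** The sum is twice the midpoint: convexity gives the midpoint, the cone property doubles it. *)
Lemma convex_cone_add (V : set L) :
  convex_set (V : set (convex_lmodType L)) -> cone V ->
  forall X Y : L, V X -> V Y -> V (X + Y).
Proof.
move=> convV coneV X Y VX VY.
have half0 : 0 <= (2^-1 : R) by rewrite invr_ge0.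
have half1 : (2^-1 : R) <= 1 by rewrite invf_le1 ?ler1n.
pose t : {i01 R} := Itv01 half0 half1.
have := convV X Y t; rewrite !inE => /(_ VX VY).
rewrite /conv/= => VXY.
have -> : X + Y = 2 *: (2^-1 *: X + (1 - 2^-1) *: Y).
  by apply/LfuneqP => w; rewrite !LinftyE; field.
exact: coneV.
Qed.

Lemma is_minimizerP (D : set L) (f : L -> \bar R) (X : L) : D X ->
  (forall Y, D Y -> (f X <= f Y)%E) -> is_minimizer D f X.
Proof.
move=> DX minX; split=> //; apply/eqP; rewrite eq_le; apply/andP; split.
  by apply: le_ereal_inf_tmp => _ [Y DY <-]; exact: minX.
by apply: ereal_inf_lbound; exists X.
Qed.

(** Both sides evaluate [rho] at [h^-1 *: X]. This yields equality in the subadditivity bound for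
    proportional shares. *)
Lemma tolerantZ (rho : L -> R) (g h : R) (X : L) : g != 0 -> h != 0 ->
  tolerant g rho ((g / h) *: X) = g / h * tolerant h rho X.
Proof.
move=> g0 h0; rewrite /tolerant scalerA mulrA; congr (_ * rho (_ *: _)).
  by rewrite mulfVK.
by rewrite mulrA mulVf// mul1r.
Qed.

Section convex_risk_measure.
Variables (rho : L -> R) (rho_crm : convex_risk_measure rho).

Lemma tolerant_decreasing (g : R) (X Y : L) : 0 < g -> ae_le X Y ->
  tolerant g rho Y <= tolerant g rho X.
Proof.
move=> g0 XY; rewrite /tolerant ler_pM2l//; apply: (crm_decreasing rho_crm).
apply: filterS XY => w /= XYw.
by rewrite ler_pM2l// invr_gt0.
Qed.

Lemma tolerant_translation (g : R) (X : L) (m : R) : 0 < g ->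
  tolerant g rho (X + Lcst P m) = tolerant g rho X - m.
Proof.
move=> g0; rewrite /tolerant.
have -> : g^-1 *: (X + Lcst P m) = g^-1 *: X + Lcst P (g^-1 * m).
  by apply/LfuneqP => w; exact: mulrDr.
by rewrite (crm_translation rho_crm) mulrBr mulrA mulfV ?gt_eqF// mul1r.
Qed.

(** Convexity at [gA^-1 *: X] and [gB^-1 *: Y] with weights [gA / (gA + gB)] and [gB / (gA + gB)]:
    the combination is [(gA + gB)^-1 *: (X + Y)], and multiplying by [gA + gB] clears the
    denominators. *)
Lemma tolerant_subadditive (gA gB : R) (X Y : L) : 0 < gA -> 0 < gB ->
  tolerant (gA + gB) rho (X + Y) <= tolerant gA rho X + tolerant gB rho Y.
Proof.
move=> gA0 gB0; have gC0 := addr_gt0 gA0 gB0.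
have t0 : 0 <= gA / (gA + gB) by rewrite divr_ge0 ?ltW.
have t1 : gA / (gA + gB) <= 1 by rewrite ler_pdivrMr// mul1r lerDl ltW.
have := @crm_convex _ _ _ _ _ rho_crm (Itv01 t0 t1) (gA^-1 *: X) (gB^-1 *: Y).
rewrite !inE => /(_ Logic.I Logic.I).
rewrite convRE /conv/= /tolerant.
have gA1 := lt0r_neq0 gA0; have gB1 := lt0r_neq0 gB0.
have gC1 := lt0r_neq0 gC0.
have -> : unstable.onem (gA / (gA + gB)) = gB / (gA + gB).
  by rewrite /unstable.onem; field.
rewrite !scalerA.
rewrite [_ / _ * gA^-1]mulrAC mulfV// mul1r.
rewrite [_ / _ * gB^-1]mulrAC mulfV// mul1r -scalerDr.
rewrite -(ler_pM2l gC0) => /le_trans; apply.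
by rewrite mulrDr !mulrA ![_ * _ / _]mulrAC mulfV// !mul1r.
Qed.

Lemma tolerant_transfer_le (gA gB : R) (XA XB xiA xiB F : L) :
  0 < gA -> 0 < gB ->
  tolerant (gA + gB) rho (XA + XB - (xiA + xiB)) <=
  tolerant gA rho (XA - F - xiA) + tolerant gB rho (XB + F - xiB).
Proof.
move=> gA0 gB0; apply: le_trans (tolerant_subadditive _ _ gA0 gB0).
by rewrite addrACA (addrACA XA) addNr addr0 -opprD.
Qed.

(** For [xi] in [V] the generated risk is at most 0 (take [m = 0]). Conversely, [xi <= m + H] gives
    [X - H <= X - xi + m], and monotonicity with translation invariance compares the risks. *)
Lemma market_modifiedE (g : R) (V : set L) (X : L) : 0 < g ->
  market_modified (tolerant g rho) V X =
  ereal_inf [set (tolerant g rho (X - xi))%:E | xi in V].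
Proof.
move=> g0; apply/eqP; rewrite eq_le; apply/andP; split.
  apply: le_ereal_inf_tmp => _ [xi Vxi <-]; apply: ge_ereal_inf.
  exists ((tolerant g rho (X - xi))%:E + generated_risk V xi)%E.
    by exists xi.
  rewrite -[leRHS]adde0 leeD2l//; apply: ereal_inf_lbound.
  exists 0 => //; exists xi => //.
  by apply: filterE => w /=; rewrite -[leLHS]add0r.
apply: le_ereal_inf_tmp => _ [H _ <-].
rewrite addeC -leeBlDr//; apply: le_ereal_inf_tmp => _ [m [xi Vxi xim] <-].
rewrite leeBlDr//; apply: ge_ereal_inf.
exists (tolerant g rho (X - xi))%:E; first by exists xi.
rewrite -EFinD lee_fin -lerBlDl -tolerant_translation//.
apply: tolerant_decreasing => //; apply: filterS xim => w /= ximw.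
have {}ximw : xi w <= m + H w by [].
by suff : X w - H w <= X w - xi w + m by []; lra.
Qed.

Section two_agents.
Variables (gA gB : R) (gA0 : 0 < gA) (gB0 : 0 < gB).
Variables (VA VB : set L) (XA XB : L).
Let gC := gA + gB.
Let objective := transfer_objective (market_modified (tolerant gA rho) VA)
  (market_modified (tolerant gB rho) VB) XA XB.

(** The transfer cancels in the total position, so a bound on joint hedging holds for every [F]. As
    [c] is an extended real, the objective at a proposed transfer can be substituted for it. *)
Lemma transfer_objective_ge (c : \bar R) (F : L) : VA !=set0 -> VB !=set0 ->
  (forall xiA xiB, VA xiA -> VB xiB ->
    (c <= (tolerant gC rho (XA + XB - (xiA + xiB)))%:E)%E) ->
  (c <= objective F)%E.
Proof.
move=> [xA VxA] [xB VxB] cV; rewrite /objective /transfer_objective.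
rewrite !market_modifiedE//; apply: lee_ereal_inf_add.
- by exists (tolerant gA rho (XA - F - xA))%:E, xA.
- by exists (tolerant gB rho (XB + F - xB))%:E, xB.
- by move=> _ [x _ <-]; exists (tolerant gA rho (XA - F - x)).
- by move=> _ [x _ <-]; exists (tolerant gB rho (XB + F - x)).
move=> _ _ [xiA VxiA <-] [xiB VxiB <-].
apply: (le_trans (cV _ _ VxiA VxiB)); rewrite -EFinD lee_fin.
exact: tolerant_transfer_le.
Qed.

Lemma transfer_objective_le (F xiA xiB : L) : VA xiA -> VB xiB ->
  (objective F <= (tolerant gA rho (XA - F - xiA)
                   + tolerant gB rho (XB + F - xiB))%:E)%E.
Proof.
move=> VxiA VxiB; rewrite /objective /transfer_objective !market_modifiedE//.
rewrite EFinD; apply: leeD; apply: ereal_inf_lbound.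
  by exists xiA.
by exists xiB.
Qed.

End two_agents.
End convex_risk_measure.
End risk_sharing.

Unset Implicit Arguments.

Theorem theorem4p4 (d : measure_display) (T : measurableType d) (R : realType)
    (P : probability T R) (rho : Linfty P -> R) (gammaA gammaB : R)
    (VA VB : set (Linfty P)) (XA XB : Linfty P) :
  let gammaC := gammaA + gammaB in
  let rhoA := tolerant gammaA rho in
  let rhoB := tolerant gammaB rho in
  let rhoC := tolerant gammaC rho in
  let rhomA := market_modified rhoA VA in
  let rhomB := market_modified rhoB VB in
  let optimal_transfer :=
    is_minimizer [set: Linfty P] (transfer_objective rhomA rhomB XA XB) in
  convex_risk_measure rho ->
  continuous_from_above rho ->
  0 < gammaA -> 0 < gammaB ->
  VA !=set0 -> VB !=set0 ->
  convex_set (VA : set (convex_lmodType (Linfty P))) ->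
  convex_set (VB : set (convex_lmodType (Linfty P))) ->
  (exists Q : probability T R, equivalent_probability P Q /\
    forall xi, (VA `|` VB) xi -> ('E_Q[\- xi] <= 0)%E) ->
  (-oo < inf_convolution rhomA rhomB 0%R)%E ->
  (VA = VB -> cone VA ->
    optimal_transfer ((gammaB / (gammaA + gammaB)) *: XA
                      - (gammaA / (gammaA + gammaB)) *: XB)) /\
  (forall etaA etaB : Linfty P, VA etaA -> VB etaB ->
    let xistar := etaA + etaB in
    is_minimizer [set xiA + xiB | xiA in VA & xiB in VB]
      (fun xi => (rhoC (XA + XB - xi))%:E) xistar ->
    let F := (gammaB / (gammaA + gammaB)) *: XA
             - (gammaA / (gammaA + gammaB)) *: XB
             - (gammaB / (gammaA + gammaB)) *: etaA
             + (gammaA / (gammaA + gammaB)) *: etaB in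
    let hedgeB := fun xiB : Linfty P => (rhoB (XB + F - xiB))%:E in
    let hedgeA := fun xiA : Linfty P => (rhoA (XA - (F + xiA)))%:E in
    let shared := (gammaC^-1%:E * (rhoC (XA + XB - xistar)%R)%:E)%E in
    [/\ optimal_transfer F,
        [/\ is_minimizer VB hedgeB etaB,
            (gammaB^-1%:E * hedgeB etaB =
             gammaB^-1%:E * ereal_inf (hedgeB @` VB))%E &
            (gammaB^-1%:E * ereal_inf (hedgeB @` VB) = shared)%E] &
        [/\ is_minimizer VA hedgeA etaA,
            (gammaA^-1%:E * hedgeA etaA =
             gammaA^-1%:E * ereal_inf (hedgeA @` VA))%E &
            (gammaA^-1%:E * ereal_inf (hedgeA @` VA) = shared)%E]]).
Proof.
move=> gC rhoA rhoB rhoC rhomA rhomB optimal crm _ gA0 gB0 VA0 VB0 convA _ _ _.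
have gC0 : 0 < gC by exact: addr_gt0.
have [gA1 gB1 gC1] := And3 (lt0r_neq0 gA0) (lt0r_neq0 gB0) (lt0r_neq0 gC0).
have weights : gammaA / gC + gammaB / gC = 1 by rewrite -mulrDl mulfV.
split.
  move=> VAB coneV; rewrite -{VB}VAB in VB0 rhomB optimal *.
  set F := (X in optimal X); split=> //.
  apply/eqP; rewrite eq_le; apply/andP; split; last first.
    by apply: ereal_inf_lbound; exists F.
  apply: le_ereal_inf_tmp => _ [G _ <-].
  apply: transfer_objective_ge => // xiA xiB VxiA VxiB.
  have Vxi := convex_cone_add convA coneV VxiA VxiB.
  set xi := xiA + xiB in Vxi *.
  (* Each agent hedges with a tolerance-proportional share of the arbitrary total hedge [xi], so no
     optimal hedge has to exist. *)
  have VZ g : 0 < g -> VA ((g / gC) *: xi).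
    by move=> g0; apply: coneV => //; rewrite divr_gt0.
  apply: (le_trans (transfer_objective_le crm gA0 gB0 _ _ _
    (VZ _ gA0) (VZ _ gB0))).
  have -> : XA - F - (gammaA / gC) *: xi = (gammaA / gC) *: (XA + XB - xi).
    by apply/LfuneqP => w; rewrite /F !LinftyE /gC; field.
  have -> : XB + F - (gammaB / gC) *: xi = (gammaB / gC) *: (XA + XB - xi).
    by apply/LfuneqP => w; rewrite /F !LinftyE /gC; field.
  by rewrite !tolerantZ// -mulrDl weights mul1r.
move=> etaA etaB VetaA VetaB xistar [_ xistar_opt] F hedgeB hedgeA shared.
have rhoC_min xiA xiB : VA xiA -> VB xiB ->
    rhoC (XA + XB - xistar) <= rhoC (XA + XB - (xiA + xiB)).
  move=> VxiA VxiB; rewrite -lee_fin xistar_opt; apply: ereal_inf_lbound.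
  by exists (xiA + xiB) => //; exists xiA => //; exists xiB.
(* The hedge [etaA] exceeds A's share of [xistar] by [(gammaB / gC) *: etaA - (gammaA / gC) *:
   etaB]; the eta terms of [F] compensate exactly this. *)
have posA : XA - F - etaA = (gammaA / gC) *: (XA + XB - xistar).
  by apply/LfuneqP => w; rewrite /F !LinftyE /gC; field.
have posB : XB + F - etaB = (gammaB / gC) *: (XA + XB - xistar).
  by apply/LfuneqP => w; rewrite /F !LinftyE /gC; field.
have valA : rhoA (XA - F - etaA) = gammaA / gC * rhoC (XA + XB - xistar).
  by rewrite posA; exact: tolerantZ.
have valB : rhoB (XB + F - etaB) = gammaB / gC * rhoC (XA + XB - xistar).
  by rewrite posB; exact: tolerantZ.
have split_opt : rhoA (XA - F - etaA) + rhoB (XB + F - etaB) =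
    rhoC (XA + XB - xistar) by rewrite valA valB -mulrDl weights mul1r.
have split_min xiA xiB : VA xiA -> VB xiB ->
    rhoA (XA - F - etaA) + rhoB (XB + F - etaB) <=
    rhoA (XA - F - xiA) + rhoB (XB + F - xiB).
  move=> VxiA VxiB; rewrite split_opt (le_trans (rhoC_min _ _ VxiA VxiB))//.
  exact: tolerant_transfer_le.
(* The pair of hedges is jointly optimal at [F]; freezing one agent's hedge and cancelling its term
   leaves optimality for the other. *)
have optB : is_minimizer VB hedgeB etaB.
  apply: is_minimizerP => // xiB VxiB; rewrite lee_fin.
  by have := split_min _ _ VetaA VxiB; rewrite lerD2l.
have optA : is_minimizer VA hedgeA etaA.
  apply: is_minimizerP => // xiA VxiA; rewrite lee_fin.
  rewrite (opprD F etaA) (opprD F xiA) !addrA.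
  by have := split_min _ _ VxiA VetaB; rewrite lerD2r.
split.
(* The hedges [etaA], [etaB] bound the objective at [F] by the minimal joint risk, which bounds the
   objective at any [G] from below. *)
- apply: is_minimizerP => // G _.
  apply: transfer_objective_ge => // xiA xiB VxiA VxiB.
  apply: (le_trans (transfer_objective_le crm gA0 gB0 _ _ _ VetaA VetaB)).
  by rewrite lee_fin split_opt; exact: rhoC_min.
- split=> //; first by rewrite optB.2.
  rewrite -optB.2 /hedgeB /shared valB -!EFinM; congr EFin.
  by rewrite !mulrA mulVf// mul1r.
- split=> //; first by rewrite optA.2.
  rewrite -optA.2 /hedgeA /shared (opprD F) addrA valA -!EFinM; congr EFin.
  by rewrite !mulrA mulVf// mul1r.
Qed.
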